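(* Let $p$ be a prime and let $\Omega\subset \mathbb{Q}_p$ be a bounded Borel set with $0<\mathfrak{m}(\Omega)<\infty$. If $\Omega$ tiles $\mathbb{Q}_p$ by translation, then $\Omega$ is almost compact open, i.e. there exists a compact open set $\Omega'\subset\mathbb{Q}_p$ such that $\mathfrak{m}(\Omega\setminus\Omega')=\mathfrak{m}(\Omega'\setminus\Omega)=0$.
   Context: $\mathbb{Q}_p$ is the field of $p$-adic numbers with its $p$-adic absolute value $|\cdot|_p$, $\mathbb{Z}_p$ is the ring of $p$-adic integers, and $\mathfrak{m}$ is the Haar measure on the additive group $\mathbb{Q}_p$ normalized by $\mathfrak{m}(\mathbb{Z}_p)=1$. A Borel set $\Omega\subset\mathbb{Q}_p$ of positive finite Haar measure is said to tile $\mathbb{Q}_p$ by translation if there exists a set $T\subset\mathbb{Q}_p$ such that $\sum_{t\in T}1_\Omega(x-t)=1$ for $\mathfrak{m}$-almost every $x\in\mathbb{Q}_p$, where $1_\Omega$ is the indicator function of $\Omega$. *)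

(* Defs.v *)
From HB Require Import structures.
From mathcomp Require Import all_boot all_order all_algebra.
From mathcomp Require Import all_classical all_reals all_analysis.
Set Implicit Arguments. Unset Strict Implicit. Unset Printing Implicit Defensive.
Import Order.TTheory GRing.Theory Num.Theory.
Local Open Scope classical_set_scope.
Local Open Scope ring_scope.

(* The field Q_p, realised as the inverse limit                        *)
(*     Q_p  =  lim_n  Z[1/p] / p^n Z   ( = lim_n Q_p / p^n Z_p ).      *)
(* An element x is the coherent sequence (x_n)_n of its canonical      *)
(* residues x_n in Z[1/p] /\ [0, p^n) modulo p^n Z_p.                  *)

(* As for 'Z_p in MathComp, we work with the modulus pbase p := maxn p 2,
   which equals p whenever p is prime (the only case used); this keeps
   Qp p inhabited (pointed) for every p. *)
Definition pbase (p : nat) : nat := maxn p 2.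

Definition pint (p : nat) (q : rat) : Prop :=
  exists k : nat, q * (pbase p ^ k)%:R \is a Num.int.

Definition padic_seq (p : nat) (x : nat -> rat) : Prop :=
  [/\ forall n, pint p (x n),
      forall n, 0 <= x n < (pbase p ^ n)%:R &
      forall n, (x n.+1 - x n) / (pbase p ^ n)%:R \is a Num.int].

Record Qp (p : nat) : Type := QpMk {
  qp_val : nat -> rat;
  qp_valP : padic_seq p qp_val }.

Lemma padic_seq0 (p : nat) : padic_seq p (fun=> 0).
Proof.
split => [n|n|n]; first by exists 0%N; rewrite mul0r.
- by rewrite lexx /= ltr0n expn_gt0 /pbase (leq_trans _ (leq_maxr p 2)).
- by rewrite subrr mul0r.
Qed.

Definition qp0 (p : nat) : Qp p := @QpMk p (fun=> 0) (padic_seq0 p).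

HB.instance Definition _ (p : nat) := gen_eqMixin (Qp p).
HB.instance Definition _ (p : nat) := gen_choiceMixin (Qp p).
HB.instance Definition _ (p : nat) := isPointed.Build (Qp p) (qp0 p).

Definition rmod (q m : rat) : rat := q - m * (Num.floor (q / m))%:~R.

Definition qp_add_rel (p : nat) (x y z : Qp p) : Prop :=
  forall n, qp_val z n = rmod (qp_val x n + qp_val y n) (pbase p ^ n)%:R.

Definition qp_shift (p : nat) (t : Qp p) (A : set (Qp p)) : set (Qp p) :=
  [set x | exists2 y, A y & qp_add_rel y t x].

(* open ball { y : |y - x|_p <= p^-k }, k : nat : same residue mod p^k *)
Definition qp_ball (p : nat) (x : Qp p) (k : nat) : set (Qp p) :=
  [set y | qp_val y k = qp_val x k].

(* closed ball p^-k Z_p = { x : |x|_p <= p^k } *)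
Definition qp_ball0 (p : nat) (k : nat) : set (Qp p) :=
  [set x | (pbase p ^ k)%:R * qp_val x 0 \is a Num.int].

Definition Zp (p : nat) : set (Qp p) := @qp_ball0 p 0.

Definition qp_bounded (p : nat) (A : set (Qp p)) : Prop :=
  exists k : nat, A `<=` @qp_ball0 p k.

Definition qp_open (p : nat) (U : set (Qp p)) : Prop :=
  forall x, U x -> exists k : nat, qp_ball x k `<=` U.

Definition qp_compact (p : nat) (K : set (Qp p)) : Prop :=
  forall (I : Type) (U : I -> set (Qp p)),
    (forall i, qp_open (U i)) -> K `<=` \bigcup_i U i ->
    exists2 J : set I, finite_set J & K `<=` \bigcup_(i in J) U i.

Notation QpB p := (g_sigma_algebraType (@qp_open p)).

(* Haar measure on Q_p normalised by m(Z_p) = 1: a (countably additive,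
   nonnegative) measure on the Borel sets, translation invariant, with
   m(Z_p) = 1.  These conditions determine m uniquely on Borel sets. *)
Definition qp_haar (p : nat) (R : realType)
    (m : {measure set (QpB p) -> \bar R}) : Prop :=
  m (@Zp p) = (1%R)%:E /\
  forall (t : Qp p) (A : set (QpB p)), measurable A -> m (qp_shift t A) = m A.

Definition qp_tiles (p : nat) (R : realType)
    (m : {measure set (QpB p) -> \bar R}) (Om : set (QpB p)) : Prop :=
  exists T : set (Qp p),
    {ae m, forall x : QpB p,
       (\esum_(t in T) ((\1_(qp_shift t Om) x : R)%:E) = (1%R)%:E)%E}.

(* Main.v *)
Require Import Defs.
From HB Require Import structures.
From mathcomp Require Import all_boot all_order all_algebra all_field.
From mathcomp Require Import finmap zify ring lra.
From mathcomp Require Import all_classical all_reals all_analysis.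
From mathcomp Require Import measurable_realfun.
Set Implicit Arguments. Unset Strict Implicit. Unset Printing Implicit Defensive.
Import Order.TTheory GRing.Theory Num.Theory.
Local Open Scope classical_set_scope.
Local Open Scope ring_scope.

(* Let Om lie in B = p^-k Z_p. The translates of Om by T' = T /\ B tile B, so
   T' is finite, and its elements are distinct modulo p^n0 for some n0. For
   n >= n0 the function c |-> m (Om /\ (c + p^(n+1) Z_p)) on B / p^(n+1) Z_p,
   minus its translate by p^n, is killed by convolution with the indicator of
   T' and by the cyclotomic polynomial Phi_(p^(k+n+1)) in the shift operator.
   These two are coprime in Q[X], because the exponents of the former are
   distinct modulo p^(k+n), so the difference vanishes. Hence Om has the same
   density d in all discs contained in a given disc D of level n0, so
   m (Om /\ A) = d * m (A) for every Borel subset A of D; taking A = Om /\ D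
   gives d = 1 or m (Om /\ D) = 0. *)

(** * Coprimality with a cyclotomic polynomial of prime power order *)

Lemma size_sum_Xn_mul (F : fieldType) (p L : nat) : (0 < p)%N -> (0 < L)%N ->
  size (\sum_(j < p) 'X^(j * L) : {poly F}) = (p.-1 * L).+1.
Proof.
case: p => // p _ L0; rewrite big_ord_recr /= addrC size_polyDl ?size_polyXn //.
apply: (leq_ltn_trans (size_sum _ _ _)); rewrite ltnS.
apply/bigmax_leqP => i _; rewrite size_polyXn.
by rewrite ltn_pmul2r.
Qed.

Lemma uniq_map_inj (T1 T2 : eqType) (f : T1 -> T2) (s : seq T1) :
  uniq (map f s) -> {in s &, injective f}.
Proof.
elim: s => //= x s IH /andP[fx us] y z; rewrite !in_cons.
move=> /predU1P[->|ys] /predU1P[->|zs] // fyz; last exact: IH fyz.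
  by case/negP: fx; rewrite fyz map_f.
by case/negP: fx; rewrite -fyz map_f.
Qed.

(* A common root z of both polynomials would be a primitive p^(e+1)-th root of
   unity, whose minimal polynomial is the second polynomial; the
   coefficients of a multiple of it of degree < p^(e+1) are p^e-periodic,
   whereas the exponents in [s] are distinct modulo p^e. *)
Lemma coprimep_sum_Xn_cyclotomic (p e : nat) (s : seq nat) :
  prime p -> s != [::] -> uniq (map (modn^~ (p ^ e)%N) s) ->
  all (fun a => a < p * p ^ e)%N s ->
  coprimep (\sum_(a <- s) 'X^a) (\sum_(j < p) 'X^(j * p ^ e)%N : {poly rat}).
Proof.
move=> pp s0 us bs; set T := \sum_(a <- s) _; set L := (p ^ e)%N in us bs *.
set Psi := \sum_(j < p) _.
have p1 := prime_gt1 pp; have p0 := prime_gt0 pp.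
have L0 : (0 < L)%N by rewrite expn_gt0 p0.
rewrite -(coprimep_map (ratr : {rmorphism rat -> algC})); apply/negPn/negP.
move=> /closed_rootP[z]; rewrite root_gcd => /andP[Tz Pz].
have evP : (map_poly ratr Psi).[z] = \sum_(j < p) (z ^+ L) ^+ j.
  rewrite rmorph_sum horner_sum; apply: eq_bigr => j _.
  by rewrite /= map_polyXn hornerXn mulnC exprM.
have zL : z ^+ L != 1.
  apply/eqP => zL; move: Pz; rewrite rootE evP zL.
  under eq_bigr do rewrite expr1n.
  by rewrite sumr_const card_ord pnatr_eq0 -leqn0 leqNgt p0.
have zpL : z ^+ (p ^ e.+1) = 1.
  apply/eqP; rewrite expnSr -/L exprM -subr_eq0 subrX1.
  by move: Pz; rewrite rootE evP => /eqP ->; rewrite mulr0.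
have [|m mz] := @prim_order_exists algC (p ^ e.+1) z _ zpL; first by rewrite expn_gt0 p0.
move=> /(dvdn_pfactor _ _ pp)[f fe mE].
(* The order of [z] is [p ^ f], and [f <= e] would give [z ^+ L = 1], which [zL] excludes. *)
have fE : f = e.+1.
  apply/eqP; rewrite eqn_leq fe ltnNge; apply/negP => fe'.
  case/negP: zL; rewrite -(prim_order_dvd mz) mE.
  exact: dvdn_exp2l.
rewrite mE fE in mz.
have [q [qE qm qP]] := minCpolyP z.
have qT : q %| T by rewrite -qP.
have qPsi : q %| Psi by rewrite -qP.
(* [q] is the minimal polynomial of a primitive [p ^ e.+1]-th root of unity, hence cyclotomic of
   degree [p.-1 * L]. This is also the degree of [Psi], so [q] and [Psi] are associates. *)
have szq : size q = (p.-1 * L).+1.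
  rewrite -(size_map_poly (ratr : {rmorphism rat -> algC})) -qE.
  rewrite (minCpoly_cyclotomic mz) -Cintr_Cyclotomic //.
  rewrite size_map_inj_poly //; last exact: intr_inj.
  by rewrite size_Cyclotomic totient_pfactor.
have szP : size Psi = (p.-1 * L).+1 by exact: size_sum_Xn_mul.
have eqPsi : q %= Psi by rewrite -dvdp_size_eqp // szP szq.
rewrite (eqp_dvdl _ eqPsi) in qT.
have [/= h hE] := dvdpP _ _ qT.
have Tc i : T`_i = (i \in s)%:R.
  rewrite /T coef_sum; under eq_bigr do rewrite coefXn.
  have := map_uniq us; elim: (s) => [|a s' IH] /=; first by rewrite big_nil.
  move=> /andP[as' us']; rewrite big_cons IH // in_cons.
  have [->|//] := eqVneq i a; last by rewrite add0r.
  by rewrite (negPf as') addr0.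
have szT : (size T <= p * L)%N.
  apply/leq_sizeP => i iL; rewrite Tc; case: (boolP (i \in s)) => // si.
  by have := allP bs _ si; rewrite ltnNge iL.
have szh : (size h <= L)%N.
  have [->|h0] := eqVneq h 0; first by rewrite size_poly0.
  have P0 : Psi != 0 by rewrite -size_poly_eq0 szP.
  move: szT; rewrite hE size_mul // szP addnS /=.
  by rewrite -[in X in (_ <= X)%N](prednK p0) mulSn leq_add2r.
(* [h] has at most [L] coefficients, so the copies of [h] placed at multiples of [L] in [h * Psi] do
   not overlap, and [T] repeats [h] on each block. *)
have Th r j : (r < L)%N -> (j < p)%N -> T`_(r + j * L) = h`_r.
  move=> rL jp; rewrite hE mulr_sumr coef_sum (bigD1 (Ordinal jp)) //= coefMXn.
  rewrite ltnNge leq_addl /= addnK big1 ?addr0 // => i ij; rewrite coefMXn.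
  case: ltnP => // ir; have /leq_sizeP-> // := szh.
  have ij' : (i : nat) != j by [].
  have [ij2|ji|/eqP] := ltngtP i j; last by rewrite (negPf ij').
    have : (i.+1 * L <= j * L)%N by rewrite leq_mul2r ij2 orbT.
    by move: rL ir; rewrite mulSn; clear; move: (i * L)%N (j * L)%N => u v; lia.
  have : (j.+1 * L <= i * L)%N by rewrite leq_mul2r ji orbT.
  by move: rL ir; rewrite mulSn; clear; move: (i * L)%N (j * L)%N => u v; lia.
have [a sa] : exists a, a \in s by case: (s) s0 => // a s' _; exists a; rewrite mem_head.
have uT b : b \in s -> (b %% L = a %% L)%N -> b = a.
  by move=> sb; apply: (uniq_map_inj us).
pose r := (a %% L)%N; have rL : (r < L)%N by rewrite ltn_mod.
have aE : a = (r + a %/ L * L)%N by rewrite addnC -divn_eq.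
have aLp : (a %/ L < p)%N by rewrite ltn_divLR //; exact: (allP bs).
(* The coefficient of [T] at [a] is 1, so by [Th] each [r + j * L] is an exponent in [s]; being
   congruent to [a] modulo [L], it equals [a]. The cases [j = 0] and [j = 1] then contradict
   [0 < L]. *)
have sT j : (j < p)%N -> (r + j * L)%N = a.
  move=> jp; apply: uT; last by rewrite addnC modnMDl modn_mod.
  have : T`_(r + j * L) = T`_(r + a %/ L * L) by rewrite !Th.
  by rewrite !Tc -aE sa; case: (_ \in _).
have := sT 0%N p0; rewrite -(sT 1%N p1) => /eqP.
by rewrite eqn_add2l mul0n mul1n eq_sym -leqn0 leqNgt L0.
Qed.

(** * Polynomials acting on functions on the integers, with ['X] as the unit shift *)

Definition conv_poly (R : comNzRingType) (P : {poly R}) (G : int -> R) (c : int) : R :=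
  \sum_(i < size P) P`_i * G (c - i%:Z).

Lemma conv_poly_le (R : comNzRingType) (P : {poly R}) (G : int -> R) (c : int)
    (n : nat) : (size P <= n)%N ->
  conv_poly P G c = \sum_(i < n) P`_i * G (c - i%:Z).
Proof.
move=> /subnKC <-; rewrite big_split_ord /= [X in _ + X]big1 ?addr0 //.
by move=> i _; rewrite nth_default ?mul0r // leq_addr.
Qed.

Lemma conv_polyD (R : comNzRingType) (P Q : {poly R}) (G : int -> R) (c : int) :
  conv_poly (P + Q) G c = conv_poly P G c + conv_poly Q G c.
Proof.
rewrite (conv_poly_le _ _ (size_polyD P Q)).
rewrite (conv_poly_le _ _ (leq_maxl (size P) (size Q))).
rewrite (conv_poly_le _ _ (leq_maxr (size P) (size Q))) -big_split /=.
by apply: eq_bigr => i _; rewrite coefD mulrDl.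
Qed.

Lemma conv_polyCM (R : comNzRingType) (a : R) (P : {poly R}) (G : int -> R)
    (c : int) : conv_poly (a%:P * P) G c = a * conv_poly P G c.
Proof.
rewrite (@conv_poly_le _ _ _ _ (size P)); last first.
  by rewrite mul_polyC size_scale_leq.
by rewrite mulr_sumr; apply: eq_bigr => i _; rewrite coefCM mulrA.
Qed.

Lemma conv_polyXnM (R : comNzRingType) (n : nat) (P : {poly R})
    (G : int -> R) (c : int) :
  conv_poly ('X^n * P) G c = conv_poly P G (c - n%:Z).
Proof.
rewrite (@conv_poly_le _ _ _ _ (n + size P)); last first.
  by apply: leq_trans (size_polyMleq _ _) _; rewrite size_polyXn.
rewrite big_split_ord /= big1 ?add0r => [|i _]; last first.
  by rewrite coefXnM ltn_ord mul0r.
apply: eq_bigr => i _; rewrite coefXnM ltnNge leq_addr /= addKn.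
by rewrite PoszD opprD addrA.
Qed.

Lemma conv_poly_sumXn (R : comNzRingType) (I : Type) (s : seq I) (f : I -> nat)
    (G : int -> R) (c : int) :
  conv_poly (\sum_(i <- s) 'X^(f i)) G c = \sum_(i <- s) G (c - (f i)%:Z).
Proof.
elim: s => [|i s IH]; first by rewrite !big_nil /conv_poly size_poly0 big_ord0.
rewrite !big_cons conv_polyD IH -['X^_]mulr1 conv_polyXnM; congr (_ + _).
by rewrite /conv_poly size_poly1 big_ord1 coef1 mul1r subr0.
Qed.

(** ['X] acts by shifting the argument, so the polynomials that annihilate [G] at every argument
    form an ideal. *)
Lemma conv_polyM_eq0 (R : comNzRingType) (P Q : {poly R}) (G : int -> R) :
  (forall c, conv_poly P G c = 0) -> forall c, conv_poly (Q * P) G c = 0.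
Proof.
move=> P0; elim/poly_ind: Q => [|Q a IH] c.
  by rewrite mul0r /conv_poly size_poly0 big_ord0.
rewrite mulrDl conv_polyD conv_polyCM P0 mulr0 addr0.
by rewrite -['X]expr1 commr_polyXn -mulrA conv_polyXnM IH.
Qed.

(** A Bezout relation, carried over to [R], puts a nonzero constant in the ideal of polynomials
    annihilating [G]. *)
Lemma eq0_of_coprimep_conv (R : numFieldType) (P Q : {poly rat}) (G : int -> R) :
  coprimep P Q ->
  (forall c, conv_poly (map_poly ratr P) G c = 0) ->
  (forall c, conv_poly (map_poly ratr Q) G c = 0) -> forall c, G c = 0.
Proof.
move=> cPQ P0 Q0 c.
move: cPQ; rewrite -(coprimep_map (ratr : {rmorphism rat -> R})).
move=> /Bezout_coprimepP[[u v]] /= /eqpP[[a b]] /= /andP[a0 b0] uv.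
have: conv_poly (a *: (u * map_poly ratr P + v * map_poly ratr Q)) G c = 0.
  rewrite -mul_polyC conv_polyCM conv_polyD.
  by rewrite !conv_polyM_eq0 // addr0 mulr0.
rewrite uv -mul_polyC conv_polyCM.
rewrite /conv_poly size_poly1 big_ord1 coef1 mul1r subr0 => /eqP.
by rewrite mulf_eq0 (negPf b0) => /eqP.
Qed.

Lemma eq0_of_tiling_conv (R : numFieldType) (p e : nat) (s : seq nat)
    (G : int -> R) :
  prime p -> s != [::] -> uniq (map (modn^~ (p ^ e)%N) s) ->
  all (fun a => a < p * p ^ e)%N s ->
  (forall c, \sum_(a <- s) G (c - a%:Z) = 0) ->
  (forall c, \sum_(j < p) G (c - (j * p ^ e)%N%:Z) = 0) ->
  forall c, G c = 0.
Proof.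
move=> pp s0 us bs sG pG.
apply: (eq0_of_coprimep_conv (coprimep_sum_Xn_cyclotomic pp s0 us bs)) => c.
  rewrite rmorph_sum; under eq_bigr do rewrite /= map_polyXn.
  by rewrite conv_poly_sumXn.
rewrite rmorph_sum; under eq_bigr do rewrite /= map_polyXn.
by rewrite conv_poly_sumXn.
Qed.

(** * Arithmetic and compactness in Q_p *)

Section QpTheory.
Variable p : nat.

Definition pw (n : nat) : rat := (pbase p ^ n)%:R.
(** On Z[1/p] this is congruence modulo p^n Z_p. It makes sense for all rationals, so membership in
    Z[1/p] is tracked separately by [pint]. *)
Definition eqm (n : nat) (x y : rat) : bool := (x - y) / pw n \is a Num.int.

Lemma pbase_gt1 : (1 < pbase p)%N.
Proof. by rewrite /pbase leq_maxr. Qed.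

Lemma pbase_gt0 : (0 < pbase p)%N. Proof. exact: ltnW pbase_gt1. Qed.

Lemma pw_gt0 n : 0 < pw n.
Proof. by rewrite ltr0n expn_gt0 pbase_gt0. Qed.

Lemma pw_neq0 n : pw n != 0. Proof. by rewrite gt_eqF ?pw_gt0. Qed.

Lemma pwD m n : pw (m + n) = pw m * pw n.
Proof. by rewrite /pw expnD natrM. Qed.

Lemma pw0 : pw 0 = 1. Proof. by []. Qed.

Lemma pwS n : pw n.+1 = pw n * (pbase p)%:R.
Proof. by rewrite /pw expnSr natrM. Qed.

Lemma pw_int n : pw n \is a Num.int. Proof. exact: natr_int. Qed.

Lemma eqm_refl n x : eqm n x x.
Proof. by rewrite /eqm subrr mul0r rpred0. Qed.

Lemma eqm_sym n x y : eqm n x y = eqm n y x.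
Proof. by rewrite /eqm -opprB mulNr rpredN. Qed.

Lemma eqmD n x y x' y' : eqm n x y -> eqm n x' y' -> eqm n (x + x') (y + y').
Proof.
move=> h h'; rewrite /eqm (_ : _ / _ = (x - y) / pw n + (x' - y') / pw n).
  exact: rpredD.
by rewrite -mulrDl; congr (_ / _); ring.
Qed.

Lemma eqmN n x y : eqm n x y -> eqm n (- x) (- y).
Proof. by rewrite /eqm -opprD mulNr rpredN. Qed.

Lemma eqmB n x y x' y' : eqm n x y -> eqm n x' y' -> eqm n (x - x') (y - y').
Proof. by move=> h /eqmN; exact: eqmD. Qed.

Lemma eqm_trans n x y z : eqm n x y -> eqm n y z -> eqm n x z.
Proof.
move=> h h'; have := eqmD h h'; rewrite /eqm.
by rewrite (_ : x + y - (y + z) = x - z)//; ring.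
Qed.

Lemma eqm_le m n x y : (m <= n)%N -> eqm n x y -> eqm m x y.
Proof.
move=> /subnKC <-; rewrite /eqm pwD => h.
rewrite (_ : _ / _ = (x - y) / (pw m * pw (n - m)) * pw (n - m)).
  by rewrite rpredM // pw_int.
by field; rewrite !pw_neq0.
Qed.

Lemma eqmDr n z x y : eqm n (x + z) (y + z) = eqm n x y.
Proof. by rewrite /eqm (_ : x + z - (y + z) = x - y)//; ring. Qed.

Lemma eqm_addint n (c : int) x : eqm n (x + c%:~R * pw n) x.
Proof. by rewrite /eqm addrAC subrr add0r mulfK ?pw_neq0 // intr_int. Qed.

Lemma rmod_eqm n x : eqm n (rmod x (pw n)) x.
Proof.
rewrite eqm_sym /rmod mulrC.
by rewrite -[X in eqm n X _](subrK ((Num.floor (x / pw n))%:~R * pw n)) eqm_addint.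
Qed.

Lemma rmod_bound n x : 0 <= rmod x (pw n) < pw n.
Proof.
have pn := pw_gt0 n; rewrite /rmod.
have /andP[h1 h2] : (Num.floor (x / pw n))%:~R <= x / pw n < (Num.floor (x / pw n) + 1)%:~R.
  exact: floor_itv.
move: h1 h2; rewrite ler_pdivlMr // ltr_pdivrMr // intrD mulrDl mul1r => h1 h2.
by rewrite subr_ge0 mulrC h1 /= ltrBlDl.
Qed.

Lemma eqm_small n x y : 0 <= x < pw n -> 0 <= y < pw n -> eqm n x y -> x = y.
Proof.
move=> /andP[x0 xn] /andP[y0 yn] /intrP[c cE].
have pn := pw_gt0 n.
have xyE : x - y = c%:~R * pw n by rewrite -cE divfK ?pw_neq0.
suff c0 : c = 0 by apply/eqP; rewrite -subr_eq0 xyE c0 mul0r.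
have c1 : (c < 1).
  rewrite -(ltr_int rat) -(ltr_pM2r pn) -xyE mul1r; lra.
have c2 : (-1 < c).
  rewrite -(ltr_int rat) -(ltr_pM2r pn) -xyE mulN1r; lra.
lia.
Qed.

Lemma pintD x y : pint p x -> pint p y -> pint p (x + y).
Proof.
move=> [k kx] [l ly]; exists (k + l)%N; rewrite expnD natrM mulrDl rpredD //.
  by rewrite mulrA rpredM // natr_int.
by rewrite mulrCA rpredM // natr_int.
Qed.

Lemma pintN x : pint p x -> pint p (- x).
Proof. by move=> [k kx]; exists k; rewrite mulNr rpredN. Qed.

Lemma pint_int x : x \is a Num.int -> pint p x.
Proof. by move=> h; exists 0%N; rewrite mulr1. Qed.

Lemma pint_eqm n x y : eqm n x y -> pint p y -> pint p x.
Proof.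
move=> xy py; rewrite -(subrK y x); apply: pintD => //; apply: pint_int.
rewrite -[x - y](divfK (pw_neq0 n)).
by rewrite rpredM // pw_int.
Qed.

(** Coherence without the normalisation to [0, p^n): termwise operations preserve it, and reducing
    each term then gives an element of Q_p. *)
Definition coherent (u : nat -> rat) : Prop :=
  (forall n, pint p (u n)) /\ (forall n, eqm n (u n.+1) (u n)).

Lemma coherent_padic_seq u : coherent u ->
  padic_seq p (fun n => rmod (u n) (pw n)).
Proof.
move=> [up uc]; split => n.
- exact: pint_eqm (rmod_eqm n (u n)) (up n).
- exact: rmod_bound.
- apply: (@eqm_trans n _ (u n.+1)); first exact: eqm_le (rmod_eqm _ _).
  by apply: (eqm_trans (uc n)); rewrite eqm_sym rmod_eqm.
Qed.

Definition qp_lim u (hu : coherent u) : Qp p := QpMk (coherent_padic_seq hu).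

Lemma qp_limE u (hu : coherent u) n : eqm n (qp_val (qp_lim hu) n) (u n).
Proof. exact: rmod_eqm. Qed.

Lemma qp_val_bound (x : Qp p) n : 0 <= qp_val x n < pw n.
Proof. by case: x => u []. Qed.

Lemma qp_val_pint (x : Qp p) n : pint p (qp_val x n).
Proof. by case: x => u []. Qed.

Lemma qp_val_coherent (x : Qp p) : coherent (qp_val x).
Proof. by case: x => u []. Qed.

Lemma qp_val_eqm (x : Qp p) m n : (m <= n)%N -> eqm m (qp_val x n) (qp_val x m).
Proof.
move=> /subnKC <-; elim: (n - m)%N => [|d IH]; first by rewrite addn0 eqm_refl.
apply: eqm_trans IH; rewrite addnS; apply: (@eqm_le _ (m + d)); first exact: leq_addr.
exact: (qp_val_coherent x).2.
Qed.

Lemma qp_inj (x y : Qp p) : (forall n, eqm n (qp_val x n) (qp_val y n)) -> x = y.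
Proof.
move=> h; have {h} : qp_val x = qp_val y.
  by apply/funext => n; apply: (@eqm_small n) => //; exact: qp_val_bound.
case: x y => [x hx] [y hy] /= xy; subst y; congr QpMk; exact: Prop_irrelevance.
Qed.

Lemma coherent_cst q : pint p q -> coherent (fun=> q).
Proof. by move=> h; split => // n; exact: eqm_refl. Qed.

Lemma coherent_sub (x t : Qp p) : coherent (fun n => qp_val x n - qp_val t n).
Proof.
split => n; first by apply: pintD; rewrite ?pintN //; [|apply: pintN]; exact: qp_val_pint.
by apply: eqmB; exact: (qp_val_coherent _).2.
Qed.

Definition qp_sub (x t : Qp p) : Qp p := qp_lim (coherent_sub x t).

Lemma qp_subE x t n : eqm n (qp_val (qp_sub x t) n) (qp_val x n - qp_val t n).
Proof. exact: qp_limE. Qed.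

(** Addition is only given as a relation. Solving it for the first summand turns translates of sets
    into preimages under a function, which commute with set operations. *)
Lemma qp_add_relE (y t x : Qp p) : qp_add_rel y t x <-> y = qp_sub x t.
Proof.
split=> [h|->].
  apply: qp_inj => n; apply: (@eqm_trans n _ (qp_val x n - qp_val t n)); last first.
    by rewrite eqm_sym qp_subE.
  rewrite -[X in eqm n X _](addrK (qp_val t n)); apply: eqmB; last exact: eqm_refl.
  by rewrite (h n) eqm_sym rmod_eqm.
move=> n; apply: (@eqm_small n); [exact: qp_val_bound|exact: rmod_bound|].
rewrite eqm_sym; apply: (eqm_trans (rmod_eqm _ _)).
rewrite -[X in eqm n _ X](subrK (qp_val t n)); apply: eqmD; last exact: eqm_refl.
exact: qp_subE.
Qed.

Lemma qp_shiftE t (A : set (Qp p)) : qp_shift t A = (qp_sub^~ t) @^-1` A.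
Proof.
apply/seteqP; split=> x /=.
  by move=> [y Ay /qp_add_relE <-].
by move=> Ax; exists (qp_sub x t) => //; exact/qp_add_relE.
Qed.

(** The coset q + p^n Z_p when q lies in Z[1/p], and the empty set for any other q. Rational centres
    make the discs countable and their arithmetic explicit. *)
Definition disc (n : nat) (q : rat) : set (Qp p) :=
  [set y | eqm n (qp_val y n) q].

Lemma disc_eqm n q q' : eqm n q q' -> disc n q = disc n q'.
Proof.
move=> h; apply/seteqP; split=> x xq; first exact: eqm_trans xq h.
by apply: (eqm_trans xq); rewrite eqm_sym.
Qed.

Lemma disc_shift t n q : qp_shift t (disc n q) = disc n (q + qp_val t n).
Proof.
rewrite qp_shiftE; apply/seteqP; split=> x; rewrite /disc /= => h.
  rewrite -[X in eqm n X _](subrK (qp_val t n)) eqmDr.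
  by apply: eqm_trans h; rewrite eqm_sym qp_subE.
apply: (eqm_trans (qp_subE x t n)).
by rewrite -(eqmDr _ (qp_val t n)) subrK.
Qed.

Lemma qp_ballE (x : Qp p) n : qp_ball x n = disc n (qp_val x n).
Proof.
apply/seteqP; split=> y; first by rewrite /qp_ball /disc /= => ->; exact: eqm_refl.
by apply: eqm_small; exact: qp_val_bound.
Qed.

Lemma disc_le m n q x : (m <= n)%N -> disc n q x -> disc m q x.
Proof.
move=> mn h; apply: eqm_trans (eqm_le mn h).
by rewrite eqm_sym; exact: qp_val_eqm.
Qed.

Lemma disc_open n q : qp_open (disc n q).
Proof.
move=> x xq; exists n; rewrite qp_ballE => y yx; exact: eqm_trans yx xq.
Qed.

Lemma qp_of_pint q : pint p q -> exists x : Qp p, forall n, disc n q x.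
Proof. by move=> pq; exists (qp_lim (coherent_cst pq)) => m; exact: qp_limE. Qed.

(** [j] is the next digit: the residue of the integer (x - q) / p^n modulo [pbase p]. *)
Lemma eqm_split n x q : eqm n x q ->
  exists2 j, (j < pbase p)%N & eqm n.+1 x (q + j%:R * pw n).
Proof.
move=> /intrP[c cE]; exists `|c %% pbase p|%Z%N.
  rewrite -ltz_nat gez0_abs ?modz_ge0 ?ltz_pmod ?ltz_nat ?pbase_gt0 //.
  by rewrite eqz_nat -lt0n pbase_gt0.
have xE : x = q + c%:~R * pw n by rewrite -cE divfK ?pw_neq0 // addrC subrK.
have b0 : (pbase p)%:R != 0 :> rat by rewrite pnatr_eq0 -lt0n pbase_gt0.
have jE : `|(c %% pbase p)%Z|%N%:R = (c %% pbase p)%Z%:~R :> rat.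
  by rewrite pmulrn gez0_abs ?modz_ge0 // eqz_nat -lt0n pbase_gt0.
rewrite /eqm xE jE {1}(divz_eq c (pbase p)) intrD intrM pwS -pmulrn.
move: (c %/ _)%Z (c %% _)%Z => A B.
rewrite (_ : _ / _ = A%:~R) ?intr_int //.
by field; rewrite b0 pw_neq0.
Qed.

Lemma disc_split n q :
  disc n q = \bigcup_(j in `I_(pbase p)) disc n.+1 (q + j%:R * pw n).
Proof.
apply/seteqP; split=> x.
  move=> /(eqm_trans (qp_val_eqm x (leqnSn n)))/eqm_split[j jp xj].
  by exists j.
move=> [j _ /(disc_le (leqnSn n)) xj]; apply: (eqm_trans xj).
by rewrite pmulrn eqm_addint.
Qed.

Lemma trivIset_disc (D : set nat) n (f : nat -> rat) :
  {in D &, forall i j, eqm n (f i) (f j) -> i = j} ->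
  trivIset D (fun i => disc n (f i)).
Proof.
move=> Df i j Di Dj [x [xi xj]]; apply: Df; rewrite ?inE //.
by apply: eqm_trans xj; rewrite eqm_sym.
Qed.

Lemma eqm_mul_pw n k (i j : nat) : (i < pbase p ^ k)%N -> (j < pbase p ^ k)%N ->
  eqm (k + n) (i%:R * pw n) (j%:R * pw n) -> i = j.
Proof.
move=> ik jk ij; have : i%:R * pw n = j%:R * pw n.
  have b l : (l < pbase p ^ k)%N -> 0 <= l%:R * pw n < pw (k + n).
    by move=> lk; rewrite pwD ltr_pM2r ?pw_gt0 // ltr_nat lk mulr_ge0 // ltW ?pw_gt0.
  by apply: eqm_small ij; exact: b.
by move=> /(mulIf (pw_neq0 n))/eqP; rewrite eqr_nat => /eqP.
Qed.

Lemma disc_split_trivIset n q :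
  trivIset `I_(pbase p) (fun j => disc n.+1 (q + j%:R * pw n)).
Proof.
apply: trivIset_disc => i j; rewrite !inE => ip jp.
rewrite ![q + _]addrC eqmDr -(add1n n); apply: eqm_mul_pw; by rewrite expn1.
Qed.

(** As [c] runs over the residues modulo p^(k+n), these are centres of the discs of level n in p^-k
    Z_p. Functions on these discs thus become periodic functions on the integers. *)
Definition rep (k : nat) (c : int) : rat := c%:~R / pw k.

Lemma pint_rep k c : pint p (rep k c).
Proof. by exists k; rewrite divfK ?pw_neq0 // intr_int. Qed.

Lemma repD k c d : rep k (c + d) = rep k c + rep k d.
Proof. by rewrite /rep intrD mulrDl. Qed.

Lemma repN k c : rep k (- c) = - rep k c.
Proof. by rewrite /rep mulrNz mulNr. Qed.

Lemma rep_pw k n : rep k (pbase p ^ (k + n))%N = pw n.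
Proof. by rewrite /rep -pmulrn -/(pw (k + n)) pwD mulrC mulKf ?pw_neq0. Qed.

Lemma eqm_rep k n (i j : nat) :
  eqm n (rep k i) (rep k j) = (i == j %[mod pbase p ^ (k + n)]).
Proof.
rewrite -eqz_nat -!modz_nat eqz_mod_dvd /eqm /rep -mulrBl -mulrA -invfM -pwD.
rewrite -rmorphB /=; apply/intrP/dvdzP => -[c cE]; exists c; last first.
  by rewrite cE intrM -pmulrn mulfK ?pw_neq0.
apply: (@intr_inj rat); rewrite intrM -pmulrn -/(pw (k + n)) -cE.
by rewrite divfK ?pw_neq0.
Qed.

(** All residues of [x] differ by integers, so membership in p^-k Z_p can be tested at any level. *)
Lemma ball0E k n (x : Qp p) : qp_ball0 k x <-> pw k * qp_val x n \is a Num.int.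
Proof.
have h : pw k * (qp_val x n - qp_val x 0) \is a Num.int.
  have := qp_val_eqm x (leq0n n); rewrite /eqm pw0 divr1 => h.
  by rewrite rpredM // pw_int.
rewrite /qp_ball0 /= -/(pw k) -[qp_val x n](subrK (qp_val x 0)) mulrDr.
by rewrite rpredDl.
Qed.

Lemma ball0_val k (x : Qp p) n : qp_ball0 k x ->
  exists2 i, (i < pbase p ^ (k + n))%N & qp_val x n = rep k i.
Proof.
move=> xk; have : pw k * qp_val x n \is a Num.int.
  exact/ball0E.
have /andP[x0 xn] := qp_val_bound x n.
rewrite intrEge0; last by rewrite mulr_ge0 // ltW ?pw_gt0.
move=> /natrP[i iE]; exists i; last by rewrite /rep -pmulrn -iE mulrC mulKf ?pw_neq0.
by rewrite -(ltr_nat rat) -iE -/(pw (k + n)) pwD ltr_pM2l ?pw_gt0.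
Qed.

Lemma disc_rep_ball0 k n i : disc n (rep k i) `<=` @qp_ball0 p k.
Proof.
move=> x xi; apply/(ball0E k n); rewrite -[qp_val x n](subrK (rep k i)) mulrDr.
rewrite rpredD //; last by rewrite /rep mulrC divfK ?pw_neq0 // intr_int.
by rewrite -[_ - _](divfK (pw_neq0 n)) rpredM ?pw_int // rpredM ?pw_int.
Qed.

Lemma trivIset_rep k n :
  trivIset `I_(pbase p ^ (k + n)) (fun i : nat => disc n (rep k i)).
Proof.
apply: trivIset_disc => i j; rewrite !inE => ik jk; rewrite eqm_rep.
by rewrite !modn_small // => /eqP.
Qed.

Lemma ball0_disc k n :
  @qp_ball0 p k = \bigcup_(i in `I_(pbase p ^ (k + n))) disc n (rep k i%:Z).
Proof.
apply/seteqP; split => [x /(ball0_val n)[i ik xi]|x [i _ /disc_rep_ball0//]].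
by exists i => //; rewrite /disc /= xi eqm_refl.
Qed.

Lemma ball0_shift (x t : Qp p) k :
  qp_ball0 k x -> qp_ball0 k (qp_sub x t) -> qp_ball0 k t.
Proof.
rewrite !(ball0E k 0) => hx hxt.
have h : pw k * (qp_val (qp_sub x t) 0 - (qp_val x 0 - qp_val t 0)) \is a Num.int.
  by rewrite rpredM ?pw_int //; have := qp_subE x t 0; rewrite /eqm pw0 divr1.
have -> : pw k * qp_val t 0 = pw k * qp_val x 0 - pw k * qp_val (qp_sub x t) 0
   + pw k * (qp_val (qp_sub x t) 0 - (qp_val x 0 - qp_val t 0)) by ring.
by rewrite rpredD // rpredB.
Qed.

Lemma ball0_unshift (x t : Qp p) k :
  qp_ball0 k t -> qp_ball0 k (qp_sub x t) -> qp_ball0 k x.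
Proof.
rewrite !(ball0E k 0) => ht hxt.
have h : pw k * (qp_val (qp_sub x t) 0 - (qp_val x 0 - qp_val t 0)) \is a Num.int.
  by rewrite rpredM ?pw_int //; have := qp_subE x t 0; rewrite /eqm pw0 divr1.
have -> : pw k * qp_val x 0 = pw k * qp_val t 0 + pw k * qp_val (qp_sub x t) 0
   - pw k * (qp_val (qp_sub x t) 0 - (qp_val x 0 - qp_val t 0)) by ring.
by rewrite rpredB // rpredD.
Qed.

(** Each pair of distinct elements is separated at some level, hence at all higher ones; the maximum
    over the finitely many pairs serves. *)
Lemma qp_separated (s : seq (Qp p)) : exists n,
  {in s &, forall x y, eqm n (qp_val x n) (qp_val y n) -> x = y}.
Proof.
have sepP (xy : Qp p * Qp p) : exists n : nat,
    eqm n (qp_val xy.1 n) (qp_val xy.2 n) -> xy.1 = xy.2.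
  case: xy => [x y] /=; have [->|xy] := pselect (x = y); first by exists 0%N.
  apply: contrapT => /forallNP h; apply: xy; apply: qp_inj => n.
  by apply: contrapT => /negP nxy; apply: (h n) => xy; rewrite xy in nxy.
have [N NP] := choice sepP.
exists (\max_(x <- s) \max_(y <- s) N (x, y)) => x y xs ys.
set n := (\max_(x <- s) _)%N => xy.
have Nn : (N (x, y) <= n)%N.
  apply: leq_trans (leq_bigmax_seq _ xs isT).
  exact: (@leq_bigmax_seq _ _ _ (fun y => N (x, y)) y ys isT).
apply: (NP (x, y)) => /=; apply: eqm_trans (qp_val_eqm y Nn).
by rewrite eqm_sym; apply: eqm_trans (qp_val_eqm x Nn); rewrite eqm_sym (eqm_le Nn).
Qed.
End QpTheory.

(** * Compactness of discs *)

Section QpCompact.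
Variable p : nat.

(** If a disc has no finite subcover, neither has one of its subdiscs of the next level. The nested
    discs so chosen shrink to a point, and one open set around that point already covers some of
    them. *)
Lemma qp_compact_disc n q : pint p q -> qp_compact (@disc p n q).
Proof.
move=> pq I U Uo cov.
pose bad n q := ~ exists2 J : set I, finite_set J &
  @disc p n q `<=` \bigcup_(i in J) U i.
have step (nq : nat * rat) : exists q', pint p nq.2 -> bad nq.1 nq.2 ->
    [/\ pint p q', eqm p nq.1 q' nq.2 & bad nq.1.+1 q'].
  case: nq => m r /=; apply: contrapT => /forallNP h.
  have [pr br] : pint p r /\ bad m r.
    by split; apply: contrapT => h'; apply: (h r) => ? ?; exfalso; exact: h'.
  apply: br.
  have ok j : exists J : set I, finite_set J /\
      disc m.+1 (r + j%:R * pw p m) `<=` \bigcup_(i in J) U i.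
    apply: contrapT => nJ; apply: (h (r + j%:R * pw p m)) => _ _; split.
    - apply: pintD => //; apply: pint_int.
      by rewrite rpredM ?pw_int ?natr_int.
    - by rewrite pmulrn eqm_addint.
    - by move=> [J Jf JU]; apply: nJ; exists J.
  have [J JP] := choice ok.
  exists (\bigcup_(j in `I_(pbase p)) J j).
    by apply: bigcup_finite => [|j _]; [exact: finite_II|exact: (JP j).1].
  rewrite disc_split => x [j jp /(JP j).2[i Ji Ux]].
  by exists i => //; exists j.
have [s sP] := choice step; apply: contrapT => bad0.
pose u := fix u i := if i is i'.+1 then s ((n + i')%N, u i') else q.
have uP i : pint p (u i) /\ bad (n + i)%N (u i).
  elim: i => [|i [IH1 IH2]]; first by rewrite addn0.
  by have [h1 _ h2] := sP ((n + i)%N, u i) IH1 IH2; rewrite addnS.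
have uc i : eqm p (n + i) (u i.+1) (u i).
  by have [h1 h2] := uP i; have [] := sP ((n + i)%N, u i) h1 h2.
(* Below level [n] the truncated subtraction returns 0, so the sequence is constantly [q] there. *)
have vc : coherent p (fun k => u (k - n)%N).
  split=> k; first exact: (uP _).1.
  have [kn|nk] := ltnP k n.
    have -> : (k.+1 - n = 0)%N by lia.
    have -> : (k - n = 0)%N by lia.
    exact: eqm_refl.
  by rewrite subSn // -[X in eqm p X _ _](subnKC nk) uc.
pose x := qp_lim vc.
have [|i _ /(Uo i)[k kU]] := cov x.
  by apply: (eqm_trans (qp_limE vc n)); rewrite subnn eqm_refl.
(* At level [l] the chosen disc exists and lies in the ball of level [k] about [x], so [U i] alone
   covers it. *)
pose l := maxn k n.
apply: (uP (l - n)%N).2; exists [set i]; first exact: finite_set1.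
rewrite subnKC ?leq_maxr // => y yl; exists i => //; apply: kU.
rewrite qp_ballE.
have kl : (k <= l)%N := leq_maxl k n.
apply: (eqm_trans (disc_le kl yl)); rewrite eqm_sym.
exact: (disc_le kl (qp_limE vc l)).
Qed.

Lemma qp_compact_bigcup (K : nat -> set (Qp p)) (D : set nat) :
  finite_set D -> (forall i, D i -> qp_compact (K i)) -> qp_compact (\bigcup_(i in D) K i).
Proof.
move=> Df Kc I U Uo cov.
have ok i : exists J : set I, D i -> finite_set J /\ K i `<=` \bigcup_(j in J) U j.
  have [Di|nDi] := pselect (D i); last by exists set0.
  have [J Jf JU] := Kc i Di I U Uo (subset_trans (bigcup_sup Di) cov).
  by exists J.
have [J JP] := choice ok.
exists (\bigcup_(i in D) J i).
  by apply: bigcup_finite => // i Di; exact: (JP i Di).1.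
by move=> x [i Di /(JP i Di).2[j Jj Ujx]]; exists j => //; exists i.
Qed.
End QpCompact.

(** * Borel sets and Haar measure *)

Section QpBorel.
Variable p : nat.

Lemma qp_open_measurable (U : set (QpB p)) : qp_open U -> measurable U.
Proof. exact: sub_sigma_algebra. Qed.

Lemma disc_measurable n q : measurable (@disc p n q : set (QpB p)).
Proof. by apply: qp_open_measurable; exact: disc_open. Qed.

Lemma ball0_measurable k : measurable (@qp_ball0 p k : set (QpB p)).
Proof.
rewrite (ball0_disc p k 0); apply: fin_bigcup_measurable => [|i _]; first exact: finite_II.
exact: disc_measurable.
Qed.

(** Translation is continuous because subtraction respects congruences, so it suffices to look at
    the generating open sets. *)
Lemma shift_measurable t (A : set (QpB p)) :
  measurable A -> measurable (qp_shift t A : set (QpB p)).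
Proof.
move=> mA; rewrite qp_shiftE -[X in measurable X]setTI.
apply: (@measurability _ _ (QpB p) (QpB p) setT (@qp_sub p ^~ t) (@qp_open p)) => //.
move=> _ [U Uo <-]; rewrite setTI; apply: qp_open_measurable => x /Uo[k kU].
exists k; rewrite qp_ballE => y yx; apply: kU; rewrite qp_ballE /disc /=.
apply: (eqm_trans (qp_subE y t k)); rewrite eqm_sym; apply: (eqm_trans (qp_subE x t k)).
by rewrite eqm_sym; apply: eqmB => //; exact: eqm_refl.
Qed.

Lemma disc_subset_or_disjoint n l q r : (n <= l)%N ->
  @disc p l r `<=` disc n q \/ @disc p l r `&` disc n q = set0.
Proof.
move=> nl; have [h|h] := boolP (eqm p n r q); [left|right].
  by move=> x /(disc_le nl) xr; apply: (eqm_trans xr).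
apply/seteqP; split => // x [/(disc_le nl) xr xq]; case/negP: h.
by apply: eqm_trans xq; rewrite eqm_sym.
Qed.

(** A generating family closed under intersection, for the uniqueness theorem of measures. The empty
    set covers disjoint discs; the full set is a one-step exhaustion. *)
Definition discs : set (set (Qp p)) :=
  [set A | [\/ A = set0, A = setT | exists n q, A = disc n q]].

Lemma discs_setI_closed : setI_closed discs.
Proof.
have dI n l q r : (n <= l)%N -> discs (@disc p l r `&` disc n q).
  move=> nl; have [h|->] := disc_subset_or_disjoint q r nl; last exact: Or31.
  by rewrite setIidl //; apply: Or33; exists l, r.
move=> A B [->|->|[n [q ->]]]; first by rewrite set0I => _; exact: Or31.
  by rewrite setTI.
move=> [->|->|[l [r ->]]].
- by rewrite setI0; exact: Or31.
- by rewrite setIT; apply: Or33; exists n, q.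
- have [nl|ln] := leqP n l; first by rewrite setIC; exact: dI.
  by apply: dI; exact: ltnW.
Qed.

Lemma measurable_discs : (@measurable _ (QpB p)) = <<s discs >>.
Proof.
apply/seteqP; split; last first.
  apply: smallest_sub; first exact: sigma_algebra_measurable.
  move=> A [->|->|[n [q ->]]]; [exact: measurable0|exact: measurableT|].
  exact: disc_measurable.
apply: smallest_sub; first exact: smallest_sigma_algebra.
move=> U Uo.
(* An open set is the union of the discs it contains, enumerated by coding pairs of a level and a
   rational centre; every other index yields the empty set. *)
pose D i := if @choice.unpickle (nat * rat)%type i is Some nq then
  (if asbool (@disc p nq.1 nq.2 `<=` U) then @disc p nq.1 nq.2 else set0)
  else set0.
have -> : U = \bigcup_i D i.
  apply/seteqP; split=> [x Ux|x [i _]].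
    have [n nU] := Uo x Ux.
    exists (choice.pickle (n, qp_val x n)) => //; rewrite /D choice.pickleK.
    rewrite qp_ballE in nU; rewrite asboolT //; exact: eqm_refl.
  by rewrite /D; case: choice.unpickle => // -[n q]; case: asboolP => // h /h.
apply: sigma_algebra_bigcup => i; apply: sub_sigma_algebra.
rewrite /D; case: choice.unpickle => [[n q]|]; last exact: Or31.
by case: ifP => _; [apply: Or33; exists n, q|exact: Or31].
Qed.

End QpBorel.

Section QpMeasure.
Variables (p : nat) (R : realType) (m : {measure set (QpB p) -> \bar R}).
Hypothesis hm : qp_haar m.

Lemma measure_disc_pint n q : pint p q -> m (@disc p n q) = m (@disc p n 0).
Proof.
move=> /qp_of_pint[t tq]; rewrite -(hm.2 t (disc n 0)); last exact: disc_measurable.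
by rewrite disc_shift add0r; congr (m _); apply: disc_eqm; rewrite eqm_sym; exact: tq.
Qed.

Lemma pint_step n q j : pint p q -> pint p (q + j%:R * pw p n).
Proof. by move=> pq; apply: pintD => //; apply: pint_int; rewrite rpredM ?natr_int. Qed.

Lemma measure_disc_split n q (A : set (QpB p)) : measurable A ->
  m (A `&` @disc p n q) = (\sum_(j < pbase p) m (A `&` @disc p n.+1 (q + j%:R * pw p n)))%E.
Proof.
move=> mA; rewrite disc_split setI_bigcupr measure_fin_bigcup.
- by rewrite -fsbig_ord.
- exact: finite_II.
- by apply: trivIset_setIl; exact: disc_split_trivIset.
- by move=> j _; apply: measurableI => //; exact: disc_measurable.
Qed.

Lemma sume_cst (I : Type) (s : seq I) (v : \bar R) :
  (\sum_(i <- s) v = (size s)%:R%:E * v)%E.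
Proof.
rewrite mule_natl; elim: s => [|i s IH]; first by rewrite big_nil mule0n.
by rewrite big_cons IH muleS.
Qed.

(** Level 0 is the normalisation on Z_p. A disc is the disjoint union of [pbase p] discs of the next
    level, all of equal measure by translation invariance. *)
Lemma measure_disc n q : pint p q -> m (@disc p n q) = ((pbase p ^ n)%:R^-1)%:E.
Proof.
elim: n q => [|n IH] q pq.
  rewrite measure_disc_pint // invr1 -hm.1; congr (m _).
  by apply/seteqP; split=> x; rewrite /disc /eqm /Defs.Zp /qp_ball0 /mkset subr0 -/(pw p 0) pw0 divr1 mul1r.
have := measure_disc_split n q (@measurableT _ (QpB p)); rewrite setTI IH //.
rewrite (eq_bigr (fun=> m (disc n.+1 0))); last first.
  by move=> j _; rewrite setTI measure_disc_pint //; exact: pint_step.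
rewrite measure_disc_pint //.
have b0 : (pbase p)%:R != 0 :> R by rewrite pnatr_eq0 -lt0n pbase_gt0.
rewrite sume_cst -[index_enum _]enumT size_enum_ord; have : (0 <= m (@disc p n.+1 0))%E by exact: measure_ge0.
(* An infinite value is excluded because the parent disc has finite measure. *)
case: (m _) => [v _|_|].
- rewrite -EFinM => -[vE]; congr EFin.
  by rewrite expnS natrM invfM vE mulKf.
- by rewrite gt0_muley // lte_fin ltr0n pbase_gt0.
- by rewrite leeNy_eq.
Qed.

Lemma measure_ball0_fin k : (m (@qp_ball0 p k) < +oo)%E.
Proof.
rewrite (ball0_disc p k 0) measure_fin_bigcup.
- rewrite -fsbig_ord; apply: lte_sum_pinfty => i _.
  change (m (disc 0 (rep p k i)) < +oo)%E.
  by rewrite measure_disc ?ltry //; exact: pint_rep.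
- exact: finite_II.
- exact: trivIset_rep.
- by move=> i _; exact: disc_measurable.
Qed.
End QpMeasure.

(** * Bounded tiles *)

Section Tiling.
Variables (p : nat) (R : realType) (m : {measure set (QpB p) -> \bar R}).
Hypothesis hm : qp_haar m.
Variables (Om : set (QpB p)) (k : nat) (T : set (Qp p)).
Hypothesis mOm : measurable Om.
Hypothesis Omk : Om `<=` @qp_ball0 p k.
Hypothesis Om0 : (0 < m Om)%E.
Hypothesis OmT : {ae m, forall x : QpB p,
  (\esum_(t in T) ((\1_(qp_shift t Om) x : R)%:E) = (1%R)%:E)%E}.

Let Tk := T `&` @qp_ball0 p k.

Lemma integral_sum_indic (S : set (QpB p)) (X : set (Qp p)) :
  measurable S -> finite_set X ->
  (\int[m]_(x in S) (\sum_(t \in X) (\1_(qp_shift t Om) x : R)%:E) =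
   \sum_(t \in X) m (qp_shift t Om `&` S))%E.
Proof.
move=> mS Xf; rewrite ge0_integral_fsum //.
- by apply: eq_fsbigr => t _; rewrite integral_indic //; exact: shift_measurable.
- move=> t; apply/measurable_EFinP; apply: measurable_indic; exact: shift_measurable.
Qed.

(** Finite partial sums of the tiling identity are at most 1 almost everywhere; integrate over
    [S]. *)
Lemma finite_tiling_sum_le (S : set (QpB p)) (X : set (Qp p)) :
  measurable S -> finite_set X -> X `<=` T ->
  (\sum_(t \in X) m (qp_shift t Om `&` S) <= m S)%E.
Proof.
move=> mS Xf XT; rewrite -integral_sum_indic // -[leRHS]mul1e -integral_cst //.
apply: ae_ge0_le_integral => //.
- by move=> x _; apply: fsume_ge0.
- apply: emeasurable_fsum => // t.
  by apply/measurable_EFinP; apply: measurable_indic; exact: shift_measurable.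
- apply: filterS OmT => x xT _; rewrite -[leRHS]xT; apply: esum_ge.
  by exists X.
Qed.

(** The translates by elements of [Tk] stay in p^-k Z_p and all have measure [m Om > 0], so the
    finite measure of that ball bounds their number. *)
Lemma tile_shifts_finite : finite_set Tk.
Proof.
apply: contrapT => /infinite_set_fset inf.
have bk := measure_ball0_fin hm k.
have hle n : (n%:R%:E * m Om <= m (@qp_ball0 p k))%E.
  have [B BT nB] := inf n.
  apply: (@le_trans _ _ (\sum_(t \in [set` B]) m (qp_shift t Om `&` @qp_ball0 p k))%E).
    rewrite (@eq_fsbigr _ _ _ _ _ (fun=> m Om)); last first.
      move=> t; rewrite inE => /BT[_ tk]; rewrite setIidl.
        exact: hm.2.
      rewrite qp_shiftE => x /Omk; exact: ball0_unshift.
    rewrite fsbig_finite // set_fsetK sume_cst lee_pmul2r ?lee_fin ?ler_nat //.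
    by rewrite ge0_fin_numE // (le_lt_trans _ bk) // le_measure ?inE //; exact: ball0_measurable.
  apply: finite_tiling_sum_le => //; first exact: ball0_measurable.
  by move=> t /BT[].
have fOm : m Om \is a fin_num.
  by rewrite ge0_fin_numE // (le_lt_trans _ bk) // le_measure ?inE //; exact: ball0_measurable.
have fB : m (@qp_ball0 p k) \is a fin_num by rewrite ge0_fin_numE.
have Om0' : 0 < fine (m Om) by rewrite fine_gt0 // Om0 -ge0_fin_numE.
have := hle (Num.truncn (fine (m (@qp_ball0 p k)) / fine (m Om))).+1.
rewrite -(fineK fOm) -(fineK fB) -EFinM lee_fin leNgt => /negP; apply.
by rewrite -ltr_pdivrMr // truncnS_gt.
Qed.

(** Since p^-k Z_p is a group containing [Om], only translates by [Tk] meet [S]. The tiling identity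
    on [S] is then a finite sum and can be integrated termwise. *)
Lemma tiling_sum (S : set (QpB p)) : measurable S -> S `<=` @qp_ball0 p k ->
  (\sum_(t \in Tk) m (qp_shift t Om `&` S) = m S)%E.
Proof.
move=> mS Sk; rewrite -integral_sum_indic //; last exact: tile_shifts_finite.
rewrite -[RHS]mul1e -integral_cst //; apply: ge0_ae_eq_integral => //.
- apply: emeasurable_fsum => [|t]; first exact: tile_shifts_finite.
  by apply/measurable_EFinP; apply: measurable_indic; exact: shift_measurable.
- by move=> x _; apply: fsume_ge0.
apply: filterS OmT => x xT xS /=; rewrite -[RHS]xT.
rewrite (esumID (@qp_ball0 p k)) // [X in (_ + X)%E]esum1 ?adde0.
  by rewrite esum_fset //; exact: tile_shifts_finite.
move=> t [Tt ntk]; rewrite indicE memNset // qp_shiftE => /Omk.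
by move=> /(ball0_shift (Sk _ xS)).
Qed.
End Tiling.

(** * Equidistribution of the tile inside discs of a fixed level *)

Section Density.
Variables (p : nat) (R : realType) (m : {measure set (QpB p) -> \bar R}).
Hypothesis hm : qp_haar m.
Variables (Om : set (QpB p)) (k : nat).
Hypothesis mOm : measurable Om.
Hypothesis finOm : (m Om < +oo)%E.

Definition discm n q : R := fine (m (Om `&` @disc p n q)).

Lemma discmE n q : m (Om `&` @disc p n q) = (discm n q)%:E.
Proof.
rewrite fineK // ge0_fin_numE // (le_lt_trans _ finOm) // le_measure ?inE //.
by apply: measurableI => //; exact: disc_measurable.
Qed.

Lemma discm_eqm n q q' : eqm p n q q' -> discm n q = discm n q'.
Proof. by move=> qq'; rewrite /discm (disc_eqm qq'). Qed.

Lemma discm_split n q :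
  discm n q = \sum_(j < pbase p) discm n.+1 (q + j%:R * pw p n).
Proof.
apply: EFin_inj; rewrite -discmE measure_disc_split // -sumEFin.
by apply: eq_bigr => j _; rewrite discmE.
Qed.

(** Translation invariance moves each shift from the tile to the disc. The tiling thus becomes a
    convolution equation with right-hand side independent of [q]. *)
Lemma tiling_discm_const (X : set (Qp p)) n (q : rat) : finite_set X -> pint p q ->
  (\sum_(t \in X) m (qp_shift t Om `&` @disc p n q) = m (@disc p n q))%E ->
  \sum_(t <- fset_set X) discm n (q - qp_val t n) = (pbase p ^ n)%:R^-1.
Proof.
move=> Xf pq XE; apply: EFin_inj; rewrite -(measure_disc hm n pq) -XE.
rewrite fsbig_finite // -sumEFin; apply: eq_bigr => t _.
rewrite -discmE -(hm.2 t); last by apply: measurableI => //; exact: disc_measurable.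
congr (m _); rewrite -[q in RHS](subrK (qp_val t n)) -disc_shift.
by rewrite !qp_shiftE.
Qed.

(** The difference [G] satisfies both vanishing conditions of [eq0_of_tiling_conv] with exponent
    [k + n]: one comes from the tiling, the other from a telescoping sum. *)
Lemma discm_periodic (X : set (Qp p)) n :
  prime (pbase p) -> finite_set X -> X !=set0 -> X `<=` @qp_ball0 p k ->
  (forall S : set (QpB p), measurable S -> S `<=` @qp_ball0 p k ->
     (\sum_(t \in X) m (qp_shift t Om `&` S) = m S)%E) ->
  (forall x y, X x -> X y -> eqm p n (qp_val x n) (qp_val y n) -> x = y) ->
  forall c : int,
    discm n.+1 (rep p k c) = discm n.+1 (rep p k c + pw p n).
Proof.
move=> pp Xf X0 Xk XS Xsep.
have aex (t : Qp p) : exists i : nat, X t ->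
    (i < pbase p ^ (k + n.+1))%N /\ qp_val t n.+1 = rep p k i.
  have [Xt|nXt] := pselect (X t); last by exists 0%N.
  by have [i ik xi] := ball0_val n.+1 (Xk _ Xt); exists i.
have [a aP] := choice aex.
pose s := map a (fset_set X).
pose f (c : int) := discm n.+1 (rep p k c).
pose L := (pbase p ^ (k + n))%N.
pose G (c : int) := f c - f (c + L%:Z).
have inX t : t \in fset_set X -> X t by rewrite in_fset_set // inE.
suff G0 c : G c = 0.
  move=> c; have := G0 c; rewrite /G /f repD rep_pw => /eqP.
  by rewrite subr_eq0 => /eqP.
apply: (@eq0_of_tiling_conv _ (pbase p) (k + n) s) => //.
- rewrite -size_eq0 size_map size_eq0; apply/eqP => s0.
  case: X0 => t Xt; have : t \in enum_fset (fset_set X).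
    by rewrite -/(t \in fset_set X) in_fset_set // inE.
  by rewrite s0.
(* The numerators [a t] are taken at level [n.+1], but modulo p^(k+n) they determine the residues at
   level [n], which [Xsep] separates. *)
- rewrite -map_comp map_inj_in_uniq ?fset_uniq // => t t' /inX Xt /inX Xt' /= aa.
  apply: Xsep => //.
  apply: (@eqm_trans _ _ _ (qp_val t n.+1)); first by rewrite eqm_sym qp_val_eqm.
  apply: (@eqm_trans _ _ _ (qp_val t' n.+1)); last exact: qp_val_eqm.
  rewrite (aP _ Xt).2 (aP _ Xt').2; by rewrite eqm_rep aa.
- apply/allP => _ /mapP[t /inX /aP[h _] ->].
  by rewrite -expnS -addnS.
(* The sum of [f] over the shifts is the same constant at [d] and at [d + L]. *)
- move=> d; rewrite big_map sumrB; apply/eqP; rewrite subr_eq0; apply/eqP.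
  have H e : \sum_(t <- fset_set X) f (e - (a t)%:Z) = (pbase p ^ n.+1)%:R^-1.
    rewrite -(@tiling_discm_const X n.+1 (rep p k e)) //.
    + rewrite !big_seq; apply: eq_bigr => t /inX Xt.
      by rewrite (aP _ Xt).2 /f repD repN.
    + exact: pint_rep.
    + by apply: XS; [exact: disc_measurable|exact: disc_rep_ball0].
  rewrite H -(H (d + L%:Z)); apply: eq_bigr => t _.
  by rewrite addrAC.
(* The sum telescopes to values of [f] at arguments differing by p^(k+n+1), that is, at centres of
   the same disc of level [n.+1]. *)
- move=> d; pose h (j : nat) := f (d + L%:Z - (j * L)%N%:Z).
  rewrite (eq_bigr (fun j : 'I_ _ => h j.+1 - h j)); last first.
    move=> j _; rewrite /h /G; congr (f _ - f _); last by rewrite addrAC.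
    by rewrite mulSn PoszD; ring.
  rewrite -(big_mkord xpredT (fun j => h j.+1 - h j)) telescope_sumr //.
  apply/eqP; rewrite subr_eq0; apply/eqP; apply: discm_eqm.
  rewrite mul0n subr0 -expnS -addnS repD repN rep_pw.
  by rewrite -mulN1r; exact: (@eqm_addint p n.+1 (-1)).
Qed.

(** By [per] the [pbase p] subdiscs of a disc carry equal parts of [Om], so each further level
    divides the measure by [pbase p]. *)
Lemma discm_density (n0 : nat) :
  (forall n (c : int), (n0 <= n)%N ->
    discm n.+1 (rep p k c) = discm n.+1 (rep p k c + pw p n)) ->
  forall n (c : int), (n0 <= n)%N ->
    discm n (rep p k c) =
    discm n0 (rep p k c) * (pbase p ^ n0)%:R * (pbase p ^ n)%:R^-1.
Proof.
move=> per n c /subnKC <-; elim: (n - n0)%N => [|d IH].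
  by rewrite addn0 mulfK // pnatr_eq0 -lt0n expn_gt0 pbase_gt0.
have b0 : (pbase p)%:R != 0 :> R by rewrite pnatr_eq0 -lt0n pbase_gt0.
suff E : discm (n0 + d) (rep p k c) =
         (pbase p)%:R * discm (n0 + d).+1 (rep p k c).
  rewrite addnS -[LHS](mulKf b0) -E IH expnS natrM invfM.
  by rewrite mulrC -!mulrA; congr (_ * (_ * _)); rewrite mulrC.
rewrite discm_split (eq_bigr (fun=> discm (n0 + d).+1 (rep p k c))).
  by rewrite sumr_const card_ord mulr_natl.
move=> j _.
(* [per] compares neighbouring subdiscs only; induction on the digit reaches all of them. *)
elim: (j : nat) => [|i IHi]; first by rewrite mul0r addr0.
rewrite -IHi mulrSr mulrDl mul1r addrA.
have -> : rep p k c + i%:R * pw p (n0 + d) =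
          rep p k (c + (i * pbase p ^ (k + (n0 + d)))%N%:Z).
  by rewrite repD -(rep_pw p k) /rep PoszM intrM -mulrA.
by rewrite -per // leq_addr.
Qed.
End Density.

(** * Constant density forces each disc to be null or full *)

Section ZeroOne.
Variables (p : nat) (R : realType) (m : {measure set (QpB p) -> \bar R}).
Hypothesis hm : qp_haar m.
Variables (Om : set (QpB p)) (k n0 : nat).
Hypothesis mOm : measurable Om.
Hypothesis finOm : (m Om < +oo)%E.
Hypothesis dens : forall n (c : int), (n0 <= n)%N ->
    discm m Om n (rep p k c) =
    discm m Om n0 (rep p k c) * (pbase p ^ n0)%:R * (pbase p ^ n)%:R^-1.

(** Both sides are finite measures in [A], so agreement on [discs] is enough. A disc of level at
    most [n0] contains [B] or misses it; a smaller one misses [B] or lies inside it, where [dens]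
    applies. *)
Lemma measure_disc_proportional (c : int) (A : set (QpB p)) : measurable A ->
  (m (A `&` (Om `&` @disc p n0 (rep p k c))) =
   (discm m Om n0 (rep p k c) * (pbase p ^ n0)%:R)%:E *
     m (A `&` @disc p n0 (rep p k c)))%E.
Proof.
set q := rep p k c; set B : set (QpB p) := disc n0 q.
have mB : measurable B by exact: disc_measurable.
have mOB : measurable (Om `&` B) by exact: measurableI.
have d0 : 0 <= discm m Om n0 q * (pbase p ^ n0)%:R.
  by rewrite mulr_ge0 // fine_ge0.
have pos : (pbase p ^ n0)%:R != 0 :> R by rewrite pnatr_eq0 -lt0n expn_gt0 pbase_gt0.
have mBE : m B = ((pbase p ^ n0)%:R^-1)%:E by rewrite measure_disc //; exact: pint_rep.
have base : m (Om `&` B) = ((discm m Om n0 q * (pbase p ^ n0)%:R)%:E * m B)%E.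
  by rewrite mBE -EFinM mulfK // discmE.
apply: (@measure_unique _ R (QpB p) (@discs p) (fun=> setT) _ _ _ _
  (mrestr m mOB) (mscale (NngNum d0) (mrestr m mB))) => //.
- exact: measurable_discs.
- exact: discs_setI_closed.
- by move=> i; exact: Or32.
- by rewrite bigcup_const.
- move=> S GS; change (m (S `&` (Om `&` B)) =
    ((discm m Om n0 q * (pbase p ^ n0)%:R)%:E * m (S `&` B))%E).
  move: GS => [->|->|[l [r ->]]].
  + by rewrite !set0I measure0 mule0.
  + by rewrite !setTI.
  + have [ln|nl] := leqP l n0.
      have [h|h] := @disc_subset_or_disjoint p l n0 r q ln.
        by rewrite (setIidr h) setIidr // => x [_ /h].
      by rewrite setICA (setIC _ B) h setI0 measure0 mule0.
    have [h|h] := @disc_subset_or_disjoint p n0 l q r (ltnW nl); last first.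
      by rewrite setICA h setI0 measure0 mule0.
    rewrite setICA (setIidl h).
    (* The centre [r] is an arbitrary rational, so the disc may be empty; otherwise any of its
       points supplies a centre of the form [rep p k i]. *)
    have [[x xr]|r0] := pselect (exists x, @disc p l r x); last first.
      have -> : @disc p l r = set0 by apply/seteqP; split => // x xr; case: r0; exists x.
      by rewrite setI0 measure0 mule0.
    have xk : qp_ball0 k x by apply: (@disc_rep_ball0 p k n0 c); exact: h.
    have [i ik xi] := ball0_val l xk.
    have rE : @disc p l r = disc l (rep p k i).
      by apply: disc_eqm; rewrite -xi eqm_sym.
    have qE : eqm p n0 (rep p k i) q.
      by rewrite -xi; apply: (eqm_trans (qp_val_eqm x (ltnW nl))); exact: h.
    rewrite rE discmE // dens ?(ltnW nl) // measure_disc //; last exact: pint_rep.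
    by rewrite (discm_eqm _ _ qE) EFinM.
- by move=> _; rewrite /= /mrestr setTI discmE // ltry.
Qed.

(** Taking [A = Om] shows that the trace of [Om] on the disc is null or the density is 1; in the
    latter case, taking the complement of [Om] gives the second alternative. *)
Lemma disc_null_or_conull (c : int) :
  m (Om `&` @disc p n0 (rep p k c)) = 0%E \/ m (@disc p n0 (rep p k c) `\` Om) = 0%E.
Proof.
have mB : measurable (@disc p n0 (rep p k c) : set (QpB p)) by exact: disc_measurable.
have := measure_disc_proportional c mOm; rewrite setIA setIid discmE // -EFinM => -[].
set d := discm m Om n0 _ => /eqP; rewrite -subr_eq0 -{1}[d]mul1r -mulrBl mulf_eq0.
move=> /orP[|/eqP->]; last by left.
rewrite subr_eq0 => /eqP dE; right.
have := measure_disc_proportional c (measurableC mOm).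
rewrite setIA setICl set0I measure0 -dE mul1e setIC => h.
by rewrite setDE.
Qed.
End ZeroOne.

Theorem theorem1p1 (p : nat) (R : realType)
    (m : {measure set (QpB p) -> \bar R}) (Om : set (QpB p)) :
  prime p ->
  qp_haar m ->
  measurable Om ->
  qp_bounded Om ->
  (0 < m Om)%E -> (m Om < +oo)%E ->
  qp_tiles m Om ->
  exists Om' : set (QpB p),
    [/\ qp_open Om', qp_compact Om',
        m (Om `\` Om') = 0%E & m (Om' `\` Om) = 0%E].
Proof.
move=> pp hm mOm [k Omk] Om0 finOm [T OmT].
have bp : prime (pbase p) by rewrite /pbase (maxn_idPl (prime_gt1 pp)).
pose Tk := T `&` @qp_ball0 p k.
have Tkf : finite_set Tk by exact: (@tile_shifts_finite p R m hm Om k T).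
have tileS := tiling_sum hm mOm Omk Om0 OmT.
(* With no shift left, the tiling identity integrated over [Om] would read [0 = m Om]. *)
have Tk0 : Tk !=set0.
  apply/set0P/eqP => Tk0; have := tileS Om mOm Omk.
  by rewrite -/Tk Tk0 fsbig_set0 => h; rewrite -h ltxx in Om0.
have inTk x : Tk x -> x \in enum_fset (fset_set Tk).
  by move=> ?; rewrite -/(x \in fset_set Tk) in_fset_set // inE.
have [n0 sep] := qp_separated (enum_fset (fset_set Tk)).
have dens : forall n (c : int), (n0 <= n)%N ->
    discm m Om n (rep p k c) =
    discm m Om n0 (rep p k c) * (pbase p ^ n0)%:R * (pbase p ^ n)%:R^-1.
  apply: discm_density => // n c n0n.
  apply: (discm_periodic hm mOm finOm bp Tkf Tk0) => //; first by move=> x [].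
  move=> x y xT yT xy; apply: sep; rewrite ?inTk //.
  (* Residues at level [n] determine those at level [n0], so separation persists at level [n]. *)
  apply: (@eqm_trans _ _ _ (qp_val x n)); first by rewrite eqm_sym qp_val_eqm.
  by apply: eqm_trans (qp_val_eqm y n0n); exact: eqm_le xy.
(* The discs of level [n0] in p^-k Z_p that meet [Om] in nonzero measure; their finite union is the
   required compact open set. *)
pose D := [set i | (i < pbase p ^ (k + n0))%N /\ m (Om `&` @disc p n0 (rep p k i)) <> 0%E].
have Df : finite_set D.
  by apply: sub_finite_set (finite_II (pbase p ^ (k + n0))) => i [].
pose Om' : set (QpB p) := \bigcup_(i in D) @disc p n0 (rep p k i%:Z).
exists Om'; split.
- move=> x [i Di /disc_open[l lU]]; exists l => y /lU yi; by exists i.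
- apply: qp_compact_bigcup => // i _; apply: qp_compact_disc; exact: pint_rep.
- have : measurable (Om `\` Om').
    apply: measurableD => //; apply: fin_bigcup_measurable => // i _; exact: disc_measurable.
  move=> mD; apply/eqP; rewrite eq_le measure_ge0 andbT.
  (* The remaining discs cover the part of [Om] outside [Om'], each meeting [Om] in measure zero. *)
  pose D' := [set i | (i < pbase p ^ (k + n0))%N /\ m (Om `&` @disc p n0 (rep p k i)) = 0%E].
  have D'f : finite_set D'.
    by apply: sub_finite_set (finite_II (pbase p ^ (k + n0))) => i [].
  apply: (@le_trans _ _ (\sum_(i \in D') m (Om `&` @disc p n0 (rep p k i%:Z)))%E); last first.
    by rewrite fsbig1 // => i [].
  apply: content_sub_fsum => //.
  + by move=> i _; apply: measurableI => //; exact: disc_measurable.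
  + move=> x [Omx nx]; have [i ik xi] := ball0_val n0 (Omk _ Omx).
    have xd : @disc p n0 (rep p k i) x by rewrite /disc /= xi eqm_refl.
    exists i => //; split=> //; apply: contrapT => h; apply: nx.
    by exists i.
- rewrite /Om' setDE setI_bigcupl; apply/eqP; rewrite eq_le measure_ge0 andbT.
  apply: (@le_trans _ _ (\sum_(i \in D) m (@disc p n0 (rep p k i%:Z) `\` Om))%E); last first.
    rewrite fsbig1 // => i [_ i0].
    (* Membership of [i] in [D] rules out the first alternative. *)
    by have [] := disc_null_or_conull hm mOm finOm dens i.
  have mdO i : measurable (@disc p n0 (rep p k i) `\` Om : set (QpB p)).
    by apply: measurableD => //; exact: disc_measurable.
  apply: content_sub_fsum => //.
  by apply: fin_bigcup_measurable => // i _; exact: mdO.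
Qed.
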